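(* Let $K_1>0$. There is a constant $C(K_1)$, depending only on $K_1$, such that the following holds. Let $X$ be a uniformly smooth complex Banach space with modulus of smoothness $\rho(u)\le\gamma u^q$ for $u\ge0$, where $1<q\le2$ and $\gamma>0$, and let $\mathcal{D}$ be a dictionary in $X$. Define the schedule $\varepsilon=\{\varepsilon_n\}_{n=1}^\infty$ by $$\varepsilon_n:=K_1\gamma^{1/q}n^{-1/p},\qquad p=\frac{q}{q-1},\quad n=1,2,\dots.$$ Then, for any $f\in A_1(\mathcal{D})$, the residuals $f_m^{c,\varepsilon}$ of the Incremental Algorithm (complex) with schedule $\varepsilon$ (IAc($\varepsilon$)) applied to $f$ with respect to $\mathcal{D}$ (for any realization) satisfy $$\|f_m^{c,\varepsilon}\|\le C(K_1)\gamma^{1/q}m^{-1/p},\qquad m=1,2,\dots.$$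
   Context: A dictionary in a complex Banach space $X$ is a set $\mathcal{D}\subset X$ such that $\|g\|\le 1$ for each $g\in\mathcal{D}$ and the closure of $\operatorname{span}\mathcal{D}$ is $X$. Put $\mathcal{D}^\circ:=\{e^{i\theta}g:\ g\in\mathcal{D},\ \theta\in[0,2\pi)\}$. $A_1(\mathcal{D})$ is the closure in $X$ of $\{\sum_{j=1}^\infty a_jg_j:\ a_j\in\mathbb{C},\ \sum_{j=1}^\infty|a_j|\le1,\ g_j\in\mathcal{D}\}$. For nonzero $h\in X$, $F_h$ denotes a norming functional of $h$: $F_h\in X^*$, $\|F_h\|=1$, $F_h(h)=\|h\|$. The modulus of smoothness of $X$ is $\rho(u):=\sup_{\|x\|=\|y\|=1}\left(\frac12(\|x+uy\|+\|x-uy\|)-1\right)$ for real $u$; $X$ is uniformly smooth if $\lim_{u\to0}\rho(u)/u=0$. IAc($\varepsilon$), for a schedule $\varepsilon=\{\varepsilon_n\}_{n=1}^\infty$, $\varepsilon_n>0$, and $f\in A_1(\mathcal{D})$: set $f_0^{c,\varepsilon}:=f$, $G_0^{c,\varepsilon}:=0$. For each $m\ge1$: (1) $\varphi_m^{c,\varepsilon}\in\mathcal{D}^\circ$ is any element satisfying $\operatorname{Re}\big(F_{f_{m-1}^{c,\varepsilon}}(\varphi_m^{c,\varepsilon}-f)\big)\ge-\varepsilon_m$ (if $f_{m-1}^{c,\varepsilon}=0$, $\varphi_m^{c,\varepsilon}\in\mathcal{D}^\circ$ is arbitrary). Let $\nu_m$ be the complex conjugate of $\operatorname{sign}F_{f_{m-1}^{c,\varepsilon}}(\varphi_m^{c,\varepsilon})$,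 where $\operatorname{sign}z:=z/|z|$ for $z\ne0$ (if $F_{f_{m-1}^{c,\varepsilon}}(\varphi_m^{c,\varepsilon})=0$ or $f_{m-1}^{c,\varepsilon}=0$, put $\nu_m:=1$). (2) $G_m^{c,\varepsilon}:=(1-1/m)G_{m-1}^{c,\varepsilon}+\nu_m\varphi_m^{c,\varepsilon}/m$. (3) $f_m^{c,\varepsilon}:=f-G_m^{c,\varepsilon}$. A realization is any sequence of choices consistent with (1)–(3). *)

(* Defs.v *)
From HB Require Import structures.
From mathcomp Require Export all_boot all_order all_algebra.
From mathcomp Require Export all_classical all_reals all_analysis.
From mathcomp Require Export complex.

Set Implicit Arguments.
Unset Strict Implicit.
Unset Printing Implicit Defensive.

Export Order.TTheory GRing.Theory Num.Theory numFieldNormedType.Exports.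

#[global] Open Scope classical_set_scope.
#[global] Open Scope ring_scope.
#[global] Open Scope complex_scope.

(** Complex Banach spaces are [completeNormedModType R[i]] with [R : realType].
    The library norm [`|x|] of such a space is a nonnegative real element of
    [R[i]]; [rnorm x] is the same number as an element of [R], so that
    [`|x| = (rnorm x)%:C]. *)
Definition rnorm (R : realType) (X : normedModType R[i]) (x : X) : R :=
  complex.Re `|x|.

Definition cspan (R : realType) (X : lmodType R[i]) (D : set X) : set X :=
  [set x | exists n (a : 'I_n -> R[i]) (g : 'I_n -> X),
     (forall j, D (g j)) /\ x = \sum_(j < n) a j *: g j].

Definition dictionary (R : realType) (X : normedModType R[i]) (D : set X) :
    Prop :=
  (forall g, D g -> rnorm g <= 1) /\ closure (cspan D) = setT.

Definition circled (R : realType) (X : lmodType R[i]) (D : set X) : set X :=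
  [set x | exists theta g, [/\ 0 <= theta < 2 * pi, D g &
     x = (cos theta +i* sin theta) *: g]].

Definition A1 (R : realType) (X : normedModType R[i]) (D : set X) : set X :=
  closure [set x : X | exists (a : nat -> R[i]) (g : nat -> X),
    [/\ forall j, D (g j),
        (\sum_(0 <= j <oo) (complex.Re `|a j|)%:E <= 1)%E &
        series (fun j => a j *: g j) @ \oo --> x]].

(** If [X = 0] the supremum is over the empty set, and has the value [0]. *)
Definition smoothness_modulus (R : realType) (X : normedModType R[i]) (u : R) :
    R :=
  sup [set r | exists x y : X, [/\ rnorm x = 1, rnorm y = 1 &
    r = (rnorm (x + u%:C *: y) + rnorm (x - u%:C *: y)) / 2 - 1]].

Definition uniformly_smooth (R : realType) (X : normedModType R[i]) : Prop :=
  smoothness_modulus X u / u @[u --> 0^'] --> (0 : R).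

(** [sup] is [0] on unbounded sets, so [dual_norm L] is the usual operator norm
    only for bounded (equivalently, continuous) [L]. *)
Definition dual_norm (R : realType) (X : normedModType R[i])
    (L : {linear X -> R[i]^o}) : R :=
  sup [set complex.Re `|L x| | x in [set x : X | rnorm x <= 1]].

Definition norming_functional (R : realType) (X : normedModType R[i]) (h : X)
    (L : {linear X -> R[i]^o}) : Prop :=
  [/\ continuous L, dual_norm L = 1 & L h = `|h|].

Definition csign (R : realType) (z : R[i]) : R[i] := z / `|z|.

(** [F h] is the norming functional of [h] (irrelevant for [h = 0]); [phi 0],
    [nu 0] and [eps 0] are not used. *)
Record IAc_realization (R : realType) (X : normedModType R[i]) (D : set X)
    (F : X -> {linear X -> R[i]^o}) (eps : nat -> R) (f : X)
    (phi : nat -> X) (nu : nat -> R[i]) (G fres : nat -> X) : Prop := {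
  IAc_norming : forall h, h != 0 -> norming_functional h (F h);
  IAc_fres0 : fres 0%N = f;
  IAc_G0 : G 0%N = 0;
  IAc_phi_mem : forall m, (1 <= m)%N -> circled D (phi m);
  IAc_phi_greedy : forall m, (1 <= m)%N -> fres m.-1 != 0 ->
    - eps m <= complex.Re (F (fres m.-1) (phi m - f));
  IAc_nu : forall m, (1 <= m)%N ->
    nu m = if (fres m.-1 == 0) || (F (fres m.-1) (phi m) == 0) then 1
           else (csign (F (fres m.-1) (phi m)))^*;
  IAc_G : forall m, (1 <= m)%N ->
    G m = (1 - m%:R^-1) *: G m.-1 + (nu m / m%:R) *: phi m;
  IAc_fres : forall m, (1 <= m)%N -> fres m = f - G m
}.

(* Main.v *)
Require Import Defs.
From mathcomp Require Import ring lra.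

(** Write [f_n] for the residuals and put [g = gamma `^ q^-1] and
    [b n = n * rnorm f_n]. The algorithm averages, so the scaled residuals obey
      [(n + 1) f_(n+1) = n f_n - y], where [y = nu phi - f]
    ([scaled_residual_step]). Both [nu phi] and [f] have norm at most 1, so
    [rnorm y <= 2]; and the choice of [phi] and [nu] gives
    [Re (F (f_n) y) >= - eps_(n+1)] ([Re_increment_ge]).

    A functional that norms [f_n] also norms [n f_n]. Hence smoothness of the
    space ([rnormB_le_smoothness]) yields
      [b (n+1) <= b n + 2 (b n) rho (2 / b n) + eps_(n+1)],
    in which [rho (2 / b n)] stands for its bound [(2 g / b n) `^ q]. The
    triangle inequality alone gives [b (n+1) <= b n + 2].

    An increment of 2 fits a bound proportional to [g] only when [g], that is
    [gamma], is bounded away from 0. This holds in every nonzero space: taking equal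
    vectors in the definition of the modulus gives [rho 2 >= 1]
    ([smoothness_modulus2_ge1]), so that [1 <= 2 g].

    What remains concerns real sequences ([recursion_growth]): when [b n] is
    below [g n `^ q^-1] the trivial increment does no harm, and above this
    threshold the increment is of order [g n `^ (q^-1 - 1)], the size of an
    increment of [g n `^ q^-1]. So [b n] is of order [g n `^ q^-1], and dividing
    by [n] gives the theorem, since [1 - q^-1 = p^-1]. *)

Set Implicit Arguments.
Unset Strict Implicit.
Unset Printing Implicit Defensive.

(** * The real-valued norm *)

Lemma normC_rnorm (R : realType) (X : normedModType R[i]) (x : X) :
  `|x| = (rnorm x)%:C.
Proof. by rewrite /rnorm RRe_real// ger0_real. Qed.

Lemma Re_le_norm (R : realType) (z : R[i]) :
  complex.Re z <= complex.Re `|z|.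
Proof.
have := normc_ge_Re z; rewrite normc_def /= lecR; exact: le_trans (ler_norm _).
Qed.

Lemma normC_real (R : realType) (u : R) : `|u%:C| = `|u|%:C.
Proof. by rewrite normc_def /= expr0n /= addr0 sqrtr_sqr. Qed.

Section rnorm_theory.
Context {R : realType} {X : normedModType R[i]}.
Implicit Types (x y : X) (u : R).

Lemma rnorm_ge0 x : 0 <= rnorm x.
Proof. by rewrite -lecR -normC_rnorm normr_ge0. Qed.

Lemma rnormD_le x y : rnorm (x + y) <= rnorm x + rnorm y.
Proof. by rewrite -lecR rmorphD /= -!normC_rnorm ler_normD. Qed.

Lemma rnormN x : rnorm (- x) = rnorm x.
Proof. by rewrite /rnorm normrN. Qed.

Lemma rnormB_le x y : rnorm (x - y) <= rnorm x + rnorm y.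
Proof. by rewrite -(rnormN y) rnormD_le. Qed.

Lemma rnorm0 : rnorm (0 : X) = 0.
Proof. by rewrite /rnorm normr0. Qed.

Lemma rnorm_gt0 x : (0 < rnorm x) = (x != 0).
Proof. by rewrite -ltcR -normC_rnorm normr_gt0. Qed.

Lemma rnormZ (a : R[i]) x : rnorm (a *: x) = complex.Re `|a| * rnorm x.
Proof. by rewrite /rnorm normrZ normC_rnorm normc_def /= mulr0 subr0. Qed.

Lemma rnormZr u x : 0 <= u -> rnorm (u%:C *: x) = u * rnorm x.
Proof. by move=> u0; rewrite rnormZ normC_real ger0_norm. Qed.

Lemma rnorm_normalize x : x != 0 -> rnorm ((rnorm x)^-1%:C *: x) = 1.
Proof.
rewrite -rnorm_gt0 => x0.
by rewrite rnormZr ?invr_ge0 ?rnorm_ge0// mulVf// gt_eqF.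
Qed.

Lemma closed_rnorm_ball u : closed [set x : X | rnorm x <= u].
Proof.
move=> x clx; apply/ler_addgt0Pr => e e0.
have eC0 : 0 < e%:C by rewrite -(rmorph0 (real_complex R)) ltcR.
have [y [/= yu]] := clx _ (nbhsx_ballx x e%:C eC0).
rewrite -ball_normE /= normC_rnorm ltcR => xy.
rewrite -(subrK y x) (le_trans (rnormD_le _ _))// addrC lerD// ltW//.
Qed.

End rnorm_theory.

(** * The atoms and the target lie in the unit ball *)

(** The triangle inequality bounds the partial sums, and closed balls absorb
    both limits: that of the series and that of the outer closure. *)
Lemma A1_rnorm_le1 (R : realType) (X : normedModType R[i]) (D : set X) f :
  (forall g, D g -> rnorm g <= 1) -> A1 D f -> rnorm f <= 1.
Proof.
move=> D1 A1f; apply: (@closed_rnorm_ball R X 1 f).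
apply: closureS A1f => x [a [g [Dg suma cvx]]].
apply: (@closed_cvg _ _ _ _ _ _ (@closed_rnorm_ball R X 1) _ _ cvx).
apply: nearW => n /=; rewrite -lee_fin.
apply: le_trans suma; apply: le_trans (nneseries_lim_ge n _); last first.
  by move=> j _ _; rewrite lee_fin; exact: (rnorm_ge0 (a j : R[i]^o)).
rewrite sumEFin lee_fin /series /=.
elim: n => [|n IHn]; first by rewrite !big_geq// rnorm0.
rewrite !big_nat_recr//=; apply: le_trans (rnormD_le _ _) _.
apply: lerD => //; rewrite rnormZ ler_piMr ?D1//.
exact: (rnorm_ge0 (a n : R[i]^o)).
Qed.

Lemma circled_rnorm_le1 (R : realType) (X : normedModType R[i]) (D : set X) x :
  (forall g, D g -> rnorm g <= 1) -> circled D x -> rnorm x <= 1.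
Proof.
move=> D1 [theta [g [_ Dg ->]]].
by rewrite rnormZ normc_def /= cos2Dsin2 sqrtr1 mul1r D1.
Qed.

(** * Norming functionals and the modulus of smoothness *)

(** Normalizing [z] places it in the unit ball over which [dual_norm L] is a
    supremum. *)
Lemma norming_functional_le (R : realType) (X : normedModType R[i]) (h : X) L z :
  norming_functional h L -> complex.Re (L z) <= rnorm z.
Proof.
case=> _ L1 _.
(* A set without a genuine supremum would have [sup] equal to 0, not 1. *)
have hasL : has_sup [set complex.Re `|L x| | x in [set x : X | rnorm x <= 1]].
  apply: contrapT => /sup_out; rewrite -/(dual_norm L) L1 => /eqP.
  by rewrite oner_eq0.
have [->|z0] := eqVneq z 0; first by rewrite linear0 rnorm0.
apply: le_trans (Re_le_norm _) _.
have : complex.Re `|L ((rnorm z)^-1%:C *: z)| <= 1.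
  rewrite -L1; apply: (sup_upper_bound hasL).
  by exists ((rnorm z)^-1%:C *: z); rewrite //= rnorm_normalize.
rewrite linearZ => normL.
have := @rnormZr _ R[i]^o (rnorm z)^-1 (L z).
rewrite invr_ge0 rnorm_ge0 => /(_ isT) Lz.
move: normL; rewrite -[complex.Re _]/(@rnorm R R[i]^o _) Lz.
by rewrite ler_pdivrMl ?rnorm_gt0// mulr1.
Qed.

Lemma norming_functionalZ (R : realType) (X : normedModType R[i]) (h : X) L
    (u : R) :
  0 <= u -> norming_functional h L -> norming_functional (u%:C *: h) L.
Proof.
move=> u0 [cL L1 Lh]; split=> //.
by rewrite linearZ Lh normrZ normC_real ger0_norm.
Qed.

Section smoothness.
Context {R : realType} {X : normedModType R[i]}.
Implicit Types (x y : X) (u : R).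

Lemma smoothness_modulus_ge x y u : 0 <= u -> rnorm x = 1 -> rnorm y = 1 ->
  (rnorm (x + u%:C *: y) + rnorm (x - u%:C *: y)) / 2 - 1
    <= smoothness_modulus X u.
Proof.
move=> u0 x1 y1; apply: ub_le_sup; last by exists x, y.
exists u => _ [a [b [a1 b1 ->]]].
have := rnormD_le a (u%:C *: b); have := rnormB_le a (u%:C *: b).
rewrite rnormZr// a1 b1; lra.
Qed.

(** The definition of the modulus, made homogeneous in [x]: apply it to the
    unit vectors in the directions of [x] and [y]. *)
Lemma smoothness_modulus_le x y : x != 0 ->
  rnorm (x + y) + rnorm (x - y)
    <= 2 * rnorm x * (1 + smoothness_modulus X (rnorm y / rnorm x)).
Proof.
move=> x0; have rx0 : 0 < rnorm x by rewrite rnorm_gt0.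
pose x1 := (rnorm x)^-1%:C *: x.
(* For [y = 0] any unit vector serves as the direction of [y]. *)
have [y1 [ry1 defy]] : exists y1 : X, rnorm y1 = 1 /\ y = (rnorm y)%:C *: y1.
  have [->|y0] := eqVneq y 0.
    by exists x1; rewrite rnorm_normalize// rnorm0 scale0r.
  exists ((rnorm y)^-1%:C *: y); rewrite rnorm_normalize// scalerA -rmorphM /=.
  by rewrite divff ?scale1r// gt_eqF// rnorm_gt0.
have u0 : 0 <= rnorm y / rnorm x by rewrite divr_ge0// rnorm_ge0.
have := smoothness_modulus_ge u0 (rnorm_normalize x0) ry1; rewrite -/x1.
have defx : x = (rnorm x)%:C *: x1.
  by rewrite scalerA -rmorphM /= divff ?scale1r// gt_eqF.
have defy' : y = (rnorm x)%:C *: ((rnorm y / rnorm x)%:C *: y1).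
  by rewrite scalerA -rmorphM /= mulrC divfK ?gt_eqF.
set r := smoothness_modulus _ _ => le_r.
have -> : rnorm (x + y) = rnorm x * rnorm (x1 + (rnorm y / rnorm x)%:C *: y1).
  by rewrite -rnormZr ?ltW// scalerDr -defx -defy'.
have -> : rnorm (x - y) = rnorm x * rnorm (x1 - (rnorm y / rnorm x)%:C *: y1).
  by rewrite -rnormZr ?ltW// scalerBr -defx -defy'.
by rewrite -mulrDr -mulrA mulrCA ler_pM2l//; lra.
Qed.

(** With both vectors equal to a unit vector [y], the average of
    [rnorm (3 y)] and [rnorm y] is 2. This is what prevents the constant in a
    power-type bound on the modulus from being small. *)
Lemma smoothness_modulus2_ge1 x : x != 0 -> 1 <= smoothness_modulus X 2.
Proof.
move=> /rnorm_normalize; move: (_ *: x) => y y1.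
apply: le_trans (smoothness_modulus_ge _ y1 y1) => //.
have -> : y + 2%:C *: y = 3%:C *: y.
  rewrite -[X in X + _]scale1r -scalerDl -(rmorph1 (real_complex R)) -rmorphD.
  by congr (_ %:C *: _); lra.
have -> : y - 2%:C *: y = - (1%:C *: y).
  rewrite -[X in X - _]scale1r -scalerBl -scaleNr.
  rewrite -(rmorph1 (real_complex R)) -rmorphB -rmorphN.
  by congr (_ %:C *: _); lra.
by rewrite rnormN !rnormZr// y1; lra.
Qed.

(** The norming functional bounds [rnorm (x + y)] from below by
    [rnorm x + Re (L y)], so smoothness bounds the other summand
    [rnorm (x - y)] from above. *)
Lemma rnormB_le_smoothness x y L : x != 0 -> norming_functional x L ->
  rnorm (x - y) <= rnorm x - complex.Re (L y)
    + 2 * rnorm x * smoothness_modulus X (rnorm y / rnorm x).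
Proof.
move=> x0 nL; have := smoothness_modulus_le y x0.
have := norming_functional_le (x + y) nL.
case: nL => _ _ Lx; rewrite linearD Lx normC_rnorm raddfD /=; lra.
Qed.

End smoothness.

(** * Growth of a real recursion *)

(** Since [1 - t <= (1 - t / 2) ^ 2], the left side is at most
    [(1 - t / 2) `^ (2 * s)], whose exponent is at least 1. *)
Lemma powR_1B_le (R : realType) (s t : R) : 2^-1 <= s -> 0 <= t <= 1 ->
  (1 - t) `^ s <= 1 - t / 2.
Proof.
move=> s2 /andP[t0 t1].
have le_sq : 1 - t <= (1 - t / 2) `^ 2.
  by rewrite -[2]/(2%:R) powR_mulrn; [nra | lra].
have s0 : 0 <= s by lra.
apply: le_trans (ge0_ler_powR s0 _ _ le_sq) _; rewrite ?nnegrE ?powR_ge0//.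
  by lra.
by rewrite -powRrM ge1r_powR//; lra.
Qed.

(** The room in an induction step for a bound by [n `^ s]: factor [n.+1] out of
    [n] and use [powR_1B_le] with [t = n.+1%:R^-1]. *)
Lemma powR_succ_increment (R : realType) (s : R) (n : nat) : 2^-1 <= s ->
  n%:R `^ s + n.+1%:R `^ (s - 1) / 2 <= n.+1%:R `^ s.
Proof.
move=> s2; have N0 : 0 < n.+1%:R :> R by rewrite ltr0n.
have -> : n%:R = n.+1%:R * (1 - n.+1%:R^-1) :> R.
  by rewrite mulrBr mulr1 mulfV ?gt_eqF// -natr1 addrK.
have t01 : 0 <= (n.+1%:R^-1 : R) <= 1.
  by rewrite invr_ge0 ltW//= invf_le1// ler1n.
rewrite powRM ?(ltW N0) ?subr_ge0 ?(andP t01).2//.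
have -> : n.+1%:R `^ (s - 1) = n.+1%:R `^ s / n.+1%:R.
  by rewrite powRB ?powRr1 ?(ltW N0)//; apply/implyP => _; rewrite gt_eqF.
have := ler_wpM2l (powR_ge0 n.+1%:R s) (powR_1B_le s2 t01).
by move: n.+1%:R^-1 ((1 - n.+1%:R^-1) `^ s) (n.+1%:R `^ s) => u v w; lra.
Qed.

(** The increments allowed here balance at the rate [n `^ q^-1]. As long as
    [b n] is below [g * n `^ q^-1], the increment 2, which is at most [4 * g],
    does not harm the bound. Above that threshold the smoothness term is at most
    [16 * g * n.+1 `^ (q^-1 - 1)], so the whole increment is at most
    [(16 + K) * g * n.+1 `^ (q^-1 - 1)], and doubling this coefficient lets
    [powR_succ_increment] absorb it. *)
Lemma recursion_growth (R : realType) (q g K : R) (b : nat -> R) :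
  1 < q <= 2 -> 1 <= 2 * g -> 0 <= K -> b 0%N = 0 ->
  (forall n, b n.+1 <= b n + 2) ->
  (forall n, 0 < b n ->
     b n.+1 <= b n + 2 * b n * (2 * g / b n) `^ q
               + K * g * n.+1%:R `^ (q^-1 - 1)) ->
  forall n, b n <= (32 + 2 * K) * g * n%:R `^ q^-1.
Proof.
move=> /andP[q1 q2] g2 K0 b0 step_triv step n.
have q0 : 0 < q by lra.
have s2 : 2^-1 <= q^-1 by rewrite lef_pV2 ?posrE//; lra.
have s1 : q^-1 <= 1 by rewrite invf_le1//; lra.
elim: n => [|n IHn]; first by rewrite b0 powR0 ?mulr0// gt_eqF// invr_gt0.
have N1 : 1 <= n.+1%:R `^ q^-1 :> R.
  by rewrite -[leLHS](powRr0 n.+1%:R) ler_powR// ?ler1n// invr_ge0 ltW.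
have le_n_N : n%:R `^ q^-1 <= n.+1%:R `^ q^-1 :> R.
  by rewrite ge0_ler_powR ?nnegrE ?invr_ge0 ?(ltW q0)// ler_nat.
have [small|large] := lerP (b n) (g * n%:R `^ q^-1).
  have gn : g * n%:R `^ q^-1 <= g * n.+1%:R `^ q^-1 by rewrite ler_wpM2l//; lra.
  have gN : g <= g * n.+1%:R `^ q^-1 by rewrite ler_peMr//; lra.
  have KgN : 0 <= K * (g * n.+1%:R `^ q^-1) by rewrite mulr_ge0//; lra.
  have := step_triv n; lra.
have bn0 : 0 < b n by apply: le_lt_trans large; rewrite mulr_ge0 ?powR_ge0//; lra.
have n0 : (0 < n)%N by case: n bn0 {IHn N1 le_n_N large} => //; rewrite b0 ltxx.
have le_N_2n : n.+1%:R `^ q^-1 <= 2 * n%:R `^ q^-1 :> R.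
  apply: (@le_trans _ _ ((2 * n%:R) `^ q^-1)).
    rewrite ge0_ler_powR ?nnegrE ?invr_ge0 ?(ltW q0)//.
    by rewrite -natrM ler_nat mul2n -addnn -addn1 leq_add2l.
  by rewrite powRM// ler_wpM2r ?powR_ge0// ler1_powR//; lra.
have le_u : 2 * g / b n <= 4 * n.+1%:R `^ (- q^-1).
  rewrite powRN ler_pdivrMr// mulrAC ler_pdivlMr ?(lt_le_trans _ N1)//.
  have := ler_wpM2l (_ : 0 <= g) le_N_2n; move/(_ ltac:(lra)); lra.
(* The exponents match because [q^-1 * (q - 1) = 1 - q^-1]; the power
   [q - 1 <= 1] does not increase the factor 4. *)
have le_uq : (2 * g / b n) `^ (q - 1) <= 4 * n.+1%:R `^ (q^-1 - 1).
  have -> : q^-1 - 1 = - q^-1 * (q - 1) by field; lra.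
  rewrite powRrM.
  apply: (@le_trans _ _ ((4 * n.+1%:R `^ (- q^-1)) `^ (q - 1))).
    rewrite ge0_ler_powR ?nnegrE ?mulr_ge0 ?powR_ge0 ?invr_ge0 ?(ltW bn0)//; lra.
  by rewrite powRM ?powR_ge0// ler_wpM2r ?powR_ge0// ler1_powR//; lra.
have smooth_term : 2 * b n * (2 * g / b n) `^ q
    = 4 * g * (2 * g / b n) `^ (q - 1).
  rewrite -mulr_powRB1 ?divr_ge0 ?(ltW bn0)//; try lra.
  by field; rewrite gt_eqF.
have gle_uq := ler_wpM2l (_ : 0 <= g) le_uq.
have incr := powR_succ_increment n s2.
have := ler_wpM2l (_ : 0 <= (32 + 2 * K) * g) incr.
move/(_ ltac:(by rewrite mulr_ge0//; lra)).
move/(_ ltac:(lra)): gle_uq.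
have := step n bn0; rewrite smooth_term; lra.
Qed.

(** * The scaled residuals of the algorithm *)

Lemma norm_conj_csign (R : realType) (z : R[i]) : z != 0 ->
  `|(csign z)^*%C| = 1.
Proof.
move=> z0; rewrite normcJ /csign normrM normfV normr_id divff//.
by rewrite normr_eq0.
Qed.

Lemma conj_csignM (R : realType) (z : R[i]) : z != 0 ->
  (csign z)^*%C * z = `|z|.
Proof.
move=> z0; have nz0 : `|z| != 0 by rewrite normr_eq0.
have {2}-> : z = csign z * `|z| by rewrite /csign divfK.
by rewrite mulrCA mulrA -sqr_normc -normcJ norm_conj_csign// expr1n mul1r.
Qed.

Section realization.
Context {R : realType} {X : normedModType R[i]} {D : set X}.
Context {F : X -> {linear X -> R[i]^o}} {eps : nat -> R} {f : X}.
Context {phi : nat -> X} {nu : nat -> R[i]} {G fres : nat -> X}.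
Context (H : IAc_realization D F eps f phi nu G fres).
Context (D1 : forall g, D g -> rnorm g <= 1) (f1 : rnorm f <= 1).

(** Multiplying the residual by its index turns the averages of the algorithm
    into plain sums: each step subtracts a vector of norm at most 2. *)
Lemma scaled_residual_step n :
  n.+1%:R *: fres n.+1 = n%:R *: fres n - (nu n.+1 *: phi n.+1 - f).
Proof.
have fresE k : fres k = f - G k.
  case: k => [|k]; last exact: (IAc_fres H).
  by rewrite (IAc_fres0 H) (IAc_G0 H) subr0.
have N0 : n.+1%:R != 0 :> R[i] by rewrite pnatr_eq0.
rewrite !fresE (IAc_G H)//= !scalerBr scalerDr !scalerA mulrBr mulr1 mulfV//.
rewrite mulrCA mulfV// mulr1 -natr1 addrK scalerDl scale1r opprB opprD.
by rewrite !addrA (addrAC _ f).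
Qed.

Lemma rnorm_increment_le2 n : rnorm (nu n.+1 *: phi n.+1 - f) <= 2.
Proof.
apply: le_trans (rnormB_le _ _) _.
suff : rnorm (nu n.+1 *: phi n.+1) <= 1 by have := f1; lra.
have -> : rnorm (nu n.+1 *: phi n.+1) = rnorm (phi n.+1).
  rewrite rnormZ (IAc_nu H)//; case: ifPn => [_|].
    by rewrite normr1 mul1r.
  by rewrite negb_or => /andP[_ Fphi0]; rewrite norm_conj_csign// mul1r.
exact: circled_rnorm_le1 D1 (IAc_phi_mem H (isT : (1 <= n.+1)%N)).
Qed.

(** The factor [nu] turns the value of the functional at [phi] into its modulus,
    which is at least its real part, so the greedy inequality survives. *)
Lemma Re_increment_ge n : fres n != 0 ->
  - eps n.+1 <= complex.Re (F (fres n) (nu n.+1 *: phi n.+1 - f)).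
Proof.
move=> fn0; apply: le_trans (IAc_phi_greedy H (isT : (1 <= n.+1)%N) fn0) _.
rewrite /= !linearB /= lerD2r linearZ /= (IAc_nu H)//= (negPf fn0) /=.
have [->|Fphi0] := eqVneq (F (fres n) (phi n.+1)) 0; first by rewrite scaler0.
have := conj_csignM Fphi0; rewrite -[_ * _]/(_ *: (_ : R[i]^o)) => ->.
exact: Re_le_norm.
Qed.

End realization.

(** * The rate of convergence *)

Theorem theorem3p5 (R : realType) (K1 : R) (hK1 : 0 < K1) :
  exists C : R,
    forall (X : completeNormedModType R[i]) (q gamma : R) (D : set X),
      uniformly_smooth X ->
      1 < q <= 2 ->
      0 < gamma ->
      (forall u : R, 0 <= u -> smoothness_modulus X u <= gamma * u `^ q) ->
      dictionary D ->
      let p := q / (q - 1) in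
      let eps := fun n : nat => K1 * gamma `^ q^-1 * n%:R `^ (- p^-1) in
      forall f : X, A1 D f ->
      forall (F : X -> {linear X -> R[i]^o}) (phi : nat -> X)
             (nu : nat -> R[i]) (G fres : nat -> X),
        IAc_realization D F eps f phi nu G fres ->
        forall m : nat, (1 <= m)%N ->
          rnorm (fres m) <= C * gamma `^ q^-1 * m%:R `^ (- p^-1).
Proof.
exists (32 + 2 * K1) => X q gamma D _ q12 gamma0 smoothX [D1 _] p eps f A1f.
move=> F phi nu G fres H m m1; have [q1 q2] := andP q12.
have q0 : 0 < q by lra.
have f1 : rnorm f <= 1 := A1_rnorm_le1 D1 A1f.
pose g := gamma `^ q^-1.
have g0 : 0 < g by rewrite powR_gt0.
have gammaE : gamma = g `^ q.
  by rewrite -powRrM mulVf ?gt_eqF// powRr1// ltW.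
have pE : - p^-1 = q^-1 - 1 by rewrite /p; field; lra.
have m0 : 0 < m%:R :> R by rewrite ltr0n.
(* In the zero space [gamma] has no lower bound, but all residuals vanish. *)
have [triv|/existsNP[x0 /eqP x0n0]] := pselect (forall x : X, x = 0).
  rewrite (triv (fres m)) rnorm0 mulr_ge0 ?powR_ge0// mulr_ge0 ?powR_ge0//; lra.
have g2 : 1 <= 2 * g.
  have rho2 : 1 <= (2 * g) `^ q.
    rewrite powRM ?(ltW g0)// -gammaE mulrC.
    exact: le_trans (smoothness_modulus2_ge1 x0n0) (smoothX _ _).
  rewrite leNgt; apply: contraTN rho2 => lt1; rewrite -ltNge.
  have g2pos : 0 < 2 * g <= 1 by rewrite (ltW lt1) andbT; lra.
  exact: le_lt_trans (ge1r_powR g2pos (ltW q1)) lt1.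
pose b n := rnorm (n%:R *: fres n).
have bE n : b n = n%:R * rnorm (fres n).
  by rewrite /b -(rmorph_nat (real_complex R)) rnormZr.
have b_le n : b n <= (32 + 2 * K1) * g * n%:R `^ q^-1.
  apply: (recursion_growth q12 g2 (ltW hK1)) => [|{}n|{}n bn0].
  - by rewrite bE mul0r.
  - rewrite /b (scaled_residual_step H); apply: le_trans (rnormB_le _ _) _.
    by rewrite lerD2l (rnorm_increment_le2 H D1 f1).
  have xn0 : n%:R *: fres n != 0 by rewrite -rnorm_gt0.
  have fn0 : fres n != 0 by apply: contraNneq xn0 => ->; rewrite scaler0.
  have normF : norming_functional (n%:R *: fres n) (F (fres n)).
    rewrite -(rmorph_nat (real_complex R)).
    exact: norming_functionalZ (IAc_norming H fn0).
  rewrite /b (scaled_residual_step H) -/(b n).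
  have := rnormB_le_smoothness (nu n.+1 *: phi n.+1 - f) xn0 normF.
  have := Re_increment_ge H fn0; rewrite -/(b n).
  set y := _ - f => greedy /le_trans; apply.
  have y2 : rnorm y <= 2 by exact: rnorm_increment_le2 H D1 f1 n.
  have bV0 : 0 < (b n)^-1 by rewrite invr_gt0.
  have rho_le : smoothness_modulus X (rnorm y / b n) <= (2 * g / b n) `^ q.
    apply: le_trans (smoothX _ _) _; first by rewrite divr_ge0 ?rnorm_ge0.
    rewrite gammaE -powRM ?divr_ge0 ?rnorm_ge0 ?(ltW g0)//.
    rewrite ge0_ler_powR ?nnegrE ?mulr_ge0 ?rnorm_ge0 ?(ltW g0) ?(ltW q0) ?(ltW bV0)//.
    by rewrite mulrA ler_wpM2r ?(ltW bV0)// mulrC ler_wpM2r ?(ltW g0).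
  move: greedy; rewrite /eps pE -/g.
  have := ler_wpM2l (_ : 0 <= 2 * b n) rho_le.
  by move/(_ ltac:(lra)); lra.
have := b_le m; rewrite bE -/g pE powRB ?powRr1 ?(ltW m0)//; last first.
  by apply/implyP => _; rewrite gt_eqF.
by rewrite mulrA ler_pdivlMr// mulrC.
Qed.
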